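(* There exists an absolute constant $C>0$ such that the following holds. For all $n\ge1$ and all non-constant $f:\{-1,1\}^n\to\{-1,1\}$, there exists a function $g_f:\{-1,1\}^n\to[0,1]$ with $\mathbb{E}[g_f^2]\le 2\,\mathrm{Var}(f)$ such that for all $1/2\le p<1$, $$\mathbb{E}\left[h_f^p\, g_f\right]\;\ge\; C\,\mathrm{Var}(f)\cdot\left(\log\left(2+\frac{e}{\sum_{i=1}^n \mathrm{Inf}_i(f)^2}\right)\right)^{p}.$$
   Context: $\mu$ is the uniform probability measure on $\{-1,1\}^n$; $\mathbb{E}$ and $\mathrm{Var}$ are taken with respect to $\mu$. For $y\in\{-1,1\}^n$, $y^{\oplus i}$ is $y$ with the $i$-th coordinate flipped. The influence is $\mathrm{Inf}_i(f)=\mu(\{y: f(y)\ne f(y^{\oplus i})\})$, and the sensitivity of $f$ at $y$ is $h_f(y)=\#\{i\in\{1,\dots,n\}: f(y)\neq f(y^{\oplus i})\}$. $\log$ is the natural logarithm. *)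

(* Defs.v *)
From mathcomp Require Import all_boot all_order all_algebra.
From mathcomp Require Import reals sequences exp.

Set Implicit Arguments.
Unset Strict Implicit.
Unset Printing Implicit Defensive.

Import Order.TTheory GRing.Theory Num.Theory.
Local Open Scope ring_scope.

(* The cube {-1,1}^n; a coordinate b : bool stands for (-1)^b, so changing the
   sign of a coordinate is boolean negation. *)
Definition cube (n : nat) := {ffun 'I_n -> bool}.

Definition flip (n : nat) (i : 'I_n) (y : cube n) : cube n :=
  [ffun j => if j == i then ~~ y j else y j].

Section UniformMeasure.
Variables (R : realType) (n : nat).
Implicit Types (A : {set cube n}) (f : cube n -> R).

Definition mu A : R := #|A|%:R / #|{: cube n}|%:R.

Definition expect f : R := \sum_(y : cube n) mu [set y] * f y.

Definition variance f : R := expect (fun y => (f y - expect f) ^+ 2).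

Definition influence f (i : 'I_n) : R := mu [set y | f y != f (flip i y)].

Definition sensitivity f (y : cube n) : nat :=
  #|[set i : 'I_n | f y != f (flip i y)]|.

End UniformMeasure.

(* Main.v *)
Require Import Defs.
From mathcomp Require Import all_boot all_order all_algebra.
From mathcomp Require Import boolp reals sequences exp.
From mathcomp Require Import zify ring lra.

Set Implicit Arguments.
Unset Strict Implicit.
Unset Printing Implicit Defensive.

Import Order.TTheory GRing.Theory Num.Theory.
Local Open Scope ring_scope.

(** The function [g] is the indicator [q] of the value that [f] takes with
probability at most 1/2, so that only the sensitive edges seen from the smaller
side are counted. Write [a], [v] for the mean and variance of [q], [W] for the
sum of the squared influences, [L] for [ln (2 + e / W)], [h] for the
sensitivity, and [m] for the expectation of [q * sqrt h]. The heart is the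
bound [v * sqrt L <= 32 * m] ([one_sided_eldan_gross]); the other exponents
follow from the pointwise inequality
[l^(p - 1/2) * (sqrt h - sqrt l) <= h^p] at a level [l] proportional to [L]
([one_sided_power]).

Two facts give the bound. The first is an isoperimetric inequality without
logarithm, [a - a^2 <= m], proved by induction on the coordinates, together
with its self-improvement under random restrictions. Apply the inequality to
the restriction of [q] to a random set of free coordinates, each free with
probability [d]. By concavity of the square root, the restrictions have on
average at most [sqrt d * m] on the right; on the left the average variance
is a Fourier sum in which level [k] has weight [1 - (1 - d)^k]. With [d = 1/D]
this says that [m] is at least of order [sqrt D] times the Fourier mass of [q]
above level [D] ([random_restriction]).

The second is that the levels between 1 and [D] carry at most half of the
variance when [D] is a small multiple of [L]. Let [T] be the noise operator
with parameter [1 / sqrt 3]. Hypercontractivity and two uses of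
Cauchy-Schwarz give [(E (T g)^2)^2 <= (E |g|)^2 * E g^2] ([noise_L1_L2]).
For [g = q] this bounds the low levels by [3^D * a^(3/2)]
([small_set_levels]). For [g = T (q - E_i q)], summed over [i], it bounds them
by [9^D * sqrt (W * v)] ([low_influence_levels]): the means
[E |g|] are at most the influences, and the extra factor [T] inside [g] keeps
the sum of the [E g^2] below [v] although the total influence of [q] may be
huge. The first bound is used when [a <= sqrt W], the second when
[sqrt W < a] ([sqrt_sensitivity_ge]). *)

(** * Positive functionals *)

Section PositiveFunctional.
Variables (R : realType) (T : Type).

(** Expectations, partial averages at a point and weighted sums over random
sets all enter through Cauchy-Schwarz and Minkowski only, which need nothing
but linearity and positivity. *)
Record positive_functional (L : (T -> R) -> R) : Prop := PositiveFunctional {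
  pf_lin : forall a f g, L (fun x => a * f x + g x) = a * L f + L g;
  pf_ge0 : forall f, (forall x, 0 <= f x) -> 0 <= L f }.

Variable L : (T -> R) -> R.
Hypothesis Lpos : positive_functional L.
Implicit Types u v : T -> R.

Lemma pf0 : L (fun=> 0) = 0.
Proof.
have := pf_lin Lpos 1 (fun=> 0) (fun=> 0).
rewrite (_ : (fun _ : T => 1 * 0 + 0) = fun=> 0); last first.
  by apply/funext => x; rewrite mulr0 addr0.
by move=> h; lra.
Qed.

Lemma pfD u v : L (fun x => u x + v x) = L u + L v.
Proof.
rewrite -[L u]mul1r -(pf_lin Lpos); congr L.
by apply/funext => x; rewrite mul1r.
Qed.

Lemma pfZ a u : L (fun x => a * u x) = a * L u.
Proof.
rewrite -[RHS]addr0 -pf0 -(pf_lin Lpos); congr L.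
by apply/funext => x; rewrite addr0.
Qed.

Lemma pfB u v : L (fun x => u x - v x) = L u - L v.
Proof.
rewrite addrC -mulN1r -(pf_lin Lpos); congr L.
by apply/funext => x; rewrite mulN1r addrC.
Qed.

Lemma pf_le u v : (forall x, u x <= v x) -> L u <= L v.
Proof.
by move=> uv; rewrite -subr_ge0 -pfB (pf_ge0 Lpos)// => x; rewrite subr_ge0.
Qed.

Lemma discriminant_le (A B C : R) :
  (forall a, 0 <= a ^+ 2 * A + a * (2 * B) + C) -> B ^+ 2 <= A * C.
Proof.
move=> h.
have C0 : 0 <= C by have := h 0; rewrite expr0n /= !mul0r !add0r.
have [A0|A0|A0] := ltgtP A 0.
- exfalso.
  have [B0|B0] := leP B 0.
    have h1 := h (1 - C / A); have K : C / A <= 0 by rewrite ler_ndivrMr// mul0r.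
    have e : C = (C / A) * A by rewrite divfK// lt_eqF.
    move: (C / A) K h1 e => c K h1 e; rewrite e in h1; nra.
  have h1 := h (- (1 - C / A)).
  have K : C / A <= 0 by rewrite ler_ndivrMr// mul0r.
  have e : C = (C / A) * A by rewrite divfK// lt_eqF.
  move: (C / A) K h1 e => c K h1 e; rewrite e in h1; nra.
- have := h (- (B / A)); have e : B = (B / A) * A by rewrite divfK// gt_eqF.
  by move: (B / A) e => b -> hb; nra.
- subst A; rewrite mul0r; have [->|B0] := eqVneq B 0; first by rewrite expr0n.
  exfalso; have := h (- (C + 1) / (2 * B)).
  rewrite mulr0 add0r divfK ?mulf_neq0 ?pnatr_eq0//; lra.
Qed.

Lemma pf_cauchy_schwarz u v :
  L (fun x => u x * v x) ^+ 2 <= L (fun x => u x ^+ 2) * L (fun x => v x ^+ 2).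
Proof.
apply: discriminant_le => a.
rewrite -(pfZ 2) -(pfZ a) -(pfZ (a ^+ 2)) -!pfD.
apply: (pf_ge0 Lpos) => x; have := sqr_ge0 (a * u x + v x); lra.
Qed.

(** Reverse form of the triangle inequality for the norm of the vector
[(L u, L v)]: project [(u, v)] on the direction of that vector at each point
and integrate. *)
Lemma pf_minkowski u v :
  L u ^+ 2 + L v ^+ 2 <= L (fun x => Num.sqrt (u x ^+ 2 + v x ^+ 2)) ^+ 2.
Proof.
set U := L u; set V := L v; set N := Num.sqrt (U ^+ 2 + V ^+ 2).
have UV0 : 0 <= U ^+ 2 + V ^+ 2 by rewrite addr_ge0 ?sqr_ge0.
have NE : N ^+ 2 = U ^+ 2 + V ^+ 2 by rewrite sqr_sqrtr.
(* [U * u + V * v <= N * sqrt (u^2 + v^2)], integrated *)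
have h : N ^+ 2 <= N * L (fun x => Num.sqrt (u x ^+ 2 + v x ^+ 2)).
  rewrite NE -pfZ !expr2 -[U * U]pfZ -[V * V]pfZ -pfD; apply: pf_le => x.
  set w := Num.sqrt _; have uv0 : 0 <= u x ^+ 2 + v x ^+ 2 by rewrite addr_ge0 ?sqr_ge0.
  have wE : w ^+ 2 = u x ^+ 2 + v x ^+ 2 by rewrite sqr_sqrtr.
  apply: (le_trans (ler_norm _)).
  rewrite -(@ler_pXn2r _ 2) ?nnegrE ?mulr_ge0 ?sqrtr_ge0//.
  rewrite real_normK ?num_real// exprMn wE NE.
  have := sqr_ge0 (U * v x - V * u x); lra.
rewrite -NE; have [->|N0] := eqVneq N 0; first by rewrite expr0n sqr_ge0.
have {}N0 : 0 < N by rewrite lt_neqAle eq_sym N0 sqrtr_ge0.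
rewrite expr2 ler_pM2l// in h; rewrite ler_pXn2r ?nnegrE ?(ltW N0)//.
by apply: (pf_ge0 Lpos) => x; exact: sqrtr_ge0.
Qed.

End PositiveFunctional.

Lemma sum_positive_functional (R : realType) (I : finType) (w : I -> R) :
  (forall i, 0 <= w i) -> positive_functional (fun f => \sum_i w i * f i).
Proof.
move=> w0; split=> [a f g|f f0].
  rewrite mulr_sumr -big_split; apply: eq_bigr => i _ /=; ring.
by apply: sumr_ge0 => i _; rewrite mulr_ge0.
Qed.

(** * Expectation on the cube *)

Section Cube.
Variables (R : realType) (n : nat).
Implicit Types (x y : cube n) (i : 'I_n) (s : seq 'I_n) (S J : {set 'I_n}).
Implicit Types (f g q : cube n -> R).

Lemma flipK i : involutive (@flip n i).
Proof.
move=> x; apply/ffunP => j; rewrite !ffunE.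
by case: eqP => // _; rewrite negbK.
Qed.

Lemma flipC i j x : flip i (flip j x) = flip j (flip i x).
Proof. by apply/ffunP => k; rewrite !ffunE; case: eqP; case: eqP. Qed.

Lemma cube_gt0 : 0 < #|{: cube n}|%:R :> R.
Proof. by rewrite ltr0n; apply/card_gt0P; exists [ffun=> false]. Qed.

Lemma expectE f : expect f = (\sum_y f y) / #|{: cube n}|%:R.
Proof.
rewrite /expect mulr_suml; apply: eq_bigr => y _.
by rewrite /mu cards1 mul1r mulrC.
Qed.

Lemma expect_pos : positive_functional (@expect R n).
Proof.
by apply: sum_positive_functional => y; rewrite /mu divr_ge0.
Qed.

Lemma expect_cst (c : R) : expect (fun _ : cube n => c) = c.
Proof.
rewrite expectE sumr_const -[c *+ _]mulr_natr mulfK//; exact/lt0r_neq0/cube_gt0.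
Qed.

Lemma expect_flip i f : expect (fun y => f (flip i y)) = expect f.
Proof.
rewrite !expectE; congr (_ / _).
by rewrite [RHS](reindex_inj (inv_inj (flipK i))).
Qed.

(** * Fourier expansion on the cube *)

Definition chi S x : R := \prod_(i in S) (-1) ^+ x i.

Definition fourier f S : R := expect (fun y => f y * chi S y).

Lemma sum_subset_prod (F G : 'I_n -> R) :
  \sum_(J : {set 'I_n}) \prod_i (if i \in J then F i else G i) =
  \prod_i (F i + G i).
Proof. by rewrite bigA_distr. Qed.

(** The sum over all characters factors over the coordinates, and a coordinate
where [x] and [y] differ contributes the factor [1 - 1]. *)
Lemma sum_chi x y :
  \sum_(S : {set 'I_n}) chi S x * chi S y = (x == y)%:R * #|{: cube n}|%:R.
Proof.
transitivity (\prod_(i < n) ((-1) ^+ x i * (-1) ^+ y i + 1 : R)).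
  rewrite -sum_subset_prod; apply: eq_bigr => S _.
  by rewrite /chi -big_split big_mkcond.
have [->|xy] := eqVneq x y.
  rewrite mul1r (eq_bigr (fun=> 2)) => [|i _]; last first.
    by rewrite -signr_addb addbb.
  by rewrite prodr_const card_ffun card_bool card_ord natrX.
have [i xyi] : exists i, x i != y i.
  by apply/existsP; apply: contraR xy; rewrite negb_exists => /forallP h;
     apply/eqP/ffunP => i; apply/eqP; rewrite -[_ == _]negbK h.
rewrite mul0r; apply/eqP/prodf_eq0; exists i => //.
by move: xyi; rewrite -negb_add negbK -signr_addb => ->; rewrite addNr.
Qed.

Lemma parseval f g : expect (fun y => f y * g y) = \sum_S fourier f S * fourier g S.
Proof.
have N0 := lt0r_neq0 cube_gt0.
under eq_bigr do rewrite /fourier !expectE mulf_div big_distrlr.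
rewrite -mulr_suml /= exchange_big /=.
under eq_bigr do rewrite exchange_big /=.
rewrite expectE.
apply: (canRL (mulfK _)); first by rewrite mulf_neq0.
rewrite mulrA divfK// mulr_suml; apply: eq_bigr => x _.
transitivity (\sum_y f x * g y * \sum_(S : {set 'I_n}) chi S x * chi S y).
  rewrite [RHS](bigD1 x)//= [X in _ = _ + X]big1 ?addr0 => [|y yx]; last first.
    by rewrite sum_chi eq_sym (negbTE yx) mul0r mulr0.
  by rewrite sum_chi eqxx mul1r.
apply: eq_bigr => y _; rewrite mulr_sumr; apply: eq_bigr => S _; ring.
Qed.

Lemma parseval_sqr f : expect (fun y => f y ^+ 2) = \sum_S fourier f S ^+ 2.
Proof. exact: parseval. Qed.

Lemma fourier_set0 f : fourier f set0 = expect f.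
Proof.
by rewrite /fourier; congr expect; apply/funext => y; rewrite /chi big_set0 mulr1.
Qed.

Lemma chi_flip S i x : chi S (flip i x) = (-1) ^+ (i \in S) * chi S x.
Proof.
rewrite /chi; have [iS|iS] := boolP (i \in S).
  rewrite (bigD1 i iS) [in RHS](bigD1 i iS) /= mulrA; congr (_ * _).
    by rewrite !ffunE eqxx; case: (x i) => /=; rewrite !(expr1, expr0); lra.
  by apply: eq_bigr => j /andP[_ /negbTE ji]; rewrite !ffunE ji.
rewrite expr0 mul1r; apply: eq_bigr => j jS; rewrite !ffunE.
by case: eqP => // ji; rewrite ji (negbTE iS) in jS.
Qed.

Lemma fourier_flip f i S :
  fourier (fun y => f (flip i y)) S = (-1) ^+ (i \in S) * fourier f S.
Proof.
rewrite /fourier -(expect_flip i) -(pfZ expect_pos); congr expect.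
by apply/funext => y; rewrite flipK chi_flip mulrCA.
Qed.

Lemma fourier_lin a f g S : fourier (fun y => a * f y + g y) S = a * fourier f S + fourier g S.
Proof.
rewrite /fourier -(pf_lin expect_pos); congr expect.
by apply/funext => y; rewrite mulrDl mulrA.
Qed.

(** * Noise operators and hypercontractivity *)

(** This is [r * f + (1 - r) * E_i f] with [E_i] the average over coordinate [i]. *)
Definition noise1 (r : R) i f x : R := (1 + r) / 2 * f x + (1 - r) / 2 * f (flip i x).

(** Applying the one-coordinate operators along a list covers two uses: with
[r = 0] it averages over the listed coordinates, and with the list of all
coordinates it is the usual noise operator. Both kinds commute with flips, which
is what makes inductions on the list possible for a fixed cube. *)
Definition noise (r : R) s f : cube n -> R := foldr (noise1 r) f s.
Arguments noise : simpl never.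

Lemma noise_cons r i s f : noise r (i :: s) f = noise1 r i (noise r s f).
Proof. by []. Qed.

Lemma noise_lin r s a f g :
  noise r s (fun y => a * f y + g y) =
  (fun y => a * noise r s f y + noise r s g y).
Proof.
elim: s => //= i s IH; rewrite !noise_cons IH; apply/funext => x.
by rewrite /noise1; ring.
Qed.

Lemma noise_ge0 r s f : 0 <= r <= 1 -> (forall x, 0 <= f x) ->
  forall x, 0 <= noise r s f x.
Proof.
move=> /andP[r0 r1] f0; elim: s => //= i s IH x.
by rewrite noise_cons /noise1 addr_ge0// mulr_ge0 ?IH//; lra.
Qed.

Lemma noise_pos r s x : 0 <= r <= 1 -> positive_functional (fun f => noise r s f x).
Proof.
by move=> r01; split=> [a f g|f f0]; [rewrite noise_lin|exact: noise_ge0].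
Qed.

Lemma noise_flip r s i f x :
  noise r s (fun y => f (flip i y)) x = noise r s f (flip i x).
Proof.
by elim: s x => //= j s IH x; rewrite !noise_cons /noise1 !IH flipC.
Qed.

Lemma noiseZ r s a f x : noise r s (fun y => a * f y) x = a * noise r s f x.
Proof.
elim: s x => //= i s IH x; rewrite !noise_cons /noise1 !IH; ring.
Qed.

Lemma noise1C r t s i f : noise1 t i (noise r s f) = noise r s (noise1 t i f).
Proof.
apply/funext => x; rewrite /noise1 -/(noise1 t i f) noise_lin noiseZ.
by rewrite noise_flip.
Qed.

Lemma noise_cst r s (c : R) x : noise r s (fun=> c) x = c.
Proof. by elim: s x => //= i s IH x; rewrite !noise_cons /noise1 !IH; lra. Qed.

Lemma noise_expect r s f : expect (noise r s f) = expect f.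
Proof.
elim: s => //= i s IH; rewrite noise_cons /noise1 (pf_lin expect_pos) (pfZ expect_pos).
by rewrite expect_flip IH; lra.
Qed.

Lemma fourier_noise r s f S :
  fourier (noise r s f) S = r ^+ count [in S] s * fourier f S.
Proof.
elim: s => [|i s IH] /=; first by rewrite expr0 mul1r.
rewrite noise_cons /noise1 fourier_lin.
have -> : fourier (fun y => (1 - r) / 2 * noise r s f (flip i y)) S =
          (1 - r) / 2 * fourier (fun y => noise r s f (flip i y)) S.
  rewrite /fourier -(pfZ expect_pos); congr expect.
  by apply/funext => y; rewrite mulrA.
rewrite fourier_flip IH; case: (i \in S) => /=.
  by rewrite add1n [r ^+ _.+1]exprS ?expr1; field.
by rewrite add0n expr0; field.
Qed.

Definition full : seq 'I_n := enum 'I_n.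

Lemma count_full S : count [in S] full = #|S|.
Proof. by rewrite -size_filter cardE /full enumT /=. Qed.

(** The difference of both sides has no nonzero Fourier coefficient. *)
Lemma noise0_full f x : noise 0 full f x = expect f.
Proof.
suff : expect (fun y => (noise 0 full f y - expect f) ^+ 2) = 0.
  rewrite expectE => /eqP; rewrite mulf_eq0 invr_eq0 (gt_eqF cube_gt0) orbF.
  rewrite psumr_eq0 => [/allP/(_ x)|y _]; last exact: sqr_ge0.
  rewrite mem_index_enum => /(_ isT) /=.
  by rewrite sqrf_eq0 subr_eq0 => /eqP.
rewrite parseval_sqr big1// => S _; apply/eqP; rewrite sqrf_eq0; apply/eqP.
have [->|/set0Pn[i iS]] := eqVneq S set0.
  by rewrite fourier_set0 (pfB expect_pos) noise_expect expect_cst subrr.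
rewrite (_ : (fun y => _) = fun y => (- expect f) * 1 + noise 0 full f y); last first.
  by apply/funext => y; rewrite mulr1 addrC.
rewrite fourier_lin fourier_noise count_full.
have S0 : (0 < #|S|)%N by apply/card_gt0P; exists i.
rewrite expr0n eqn0Ngt S0 /= mul0r addr0.
suff -> : fourier (fun=> 1) S = 0 by rewrite mulr0.
have := fourier_flip (fun=> 1) i S; rewrite iS expr1 mulN1r => h; lra.
Qed.

(** Bonami's induction, one coordinate at a time. With [e] and [d] the even
and odd parts of [f] in coordinate [i], averaging the fourth power of
[T e + r * T d] over the sign in front of [d] leaves
[(T e)^4 + 6 r^2 (T e)^2 (T d)^2 + r^4 (T d)^4], and [6 r^2 = 2] is exactly what
the square of [E e^2 + E d^2] can absorb. The average over the remaining variables
is kept at a point [x] so that the induction hypothesis applies to [e] and [d]. *)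
Lemma hypercontractivity_pointwise r s f x : 0 <= r <= 1 -> r ^+ 2 = 1 / 3 ->
  noise 0 s (fun y => noise r s f y ^+ 4) x <=
  noise 0 s (fun y => f y ^+ 2) x ^+ 2.
Proof.
move=> r01 r2; elim: s f x => [|i s IH] f x.
  by rewrite /noise /= -exprM.
rewrite !noise_cons !noise1C.
pose e y := 1/2 * f y + 1/2 * f (flip i y).
pose d y := 1/2 * f y + (- (1/2)) * f (flip i y).
have z01 : 0 <= (0 : R) <= 1 by rewrite lexx ler01.
have LP := noise_pos s x z01.
pose L := fun f => noise 0 s f x.
have eE : (fun y => noise r s e y) =
    (fun y => 1/2 * noise r s f y + 1/2 * noise r s f (flip i y)).
  by apply/funext => y; rewrite /e noise_lin noiseZ noise_flip.
have dE : (fun y => noise r s d y) =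
    (fun y => 1/2 * noise r s f y + (-(1/2)) * noise r s f (flip i y)).
  by apply/funext => y; rewrite /d noise_lin noiseZ noise_flip.
have -> : noise1 0 i (fun y => noise r s (noise1 r i f) y ^+ 4) =
  (fun y => noise r s e y ^+ 4 +
     (2 * (noise r s e y ^+ 2 * noise r s d y ^+ 2) + 1/9 * noise r s d y ^+ 4)).
  apply/funext => y; rewrite -[noise r s e]/(fun y => noise r s e y) eE.
  rewrite -[noise r s d]/(fun y => noise r s d y) dE.
  rewrite -noise1C /noise1 flipK.
  have r4 : r ^+ 4 = 1/9 by rewrite (exprM r 2 2) r2; lra.
  set A := noise r s f y; set B := noise r s f (flip i y).
  transitivity ((1/2 * A + 1/2 * B)^+4 + (6 * r^+2 * ((1/2 * A + 1/2 * B)^+2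
    * (1/2 * A + - (1/2) * B)^+2) + r^+4 * (1/2 * A + - (1/2) * B)^+4)); first by field.
  by rewrite r2 r4; field.
have -> : noise1 0 i (fun y => f y ^+ 2) = (fun y => e y ^+ 2 + d y ^+ 2).
  by apply/funext => y; rewrite /noise1 /e /d; field.
rewrite !(pfD LP) !(pfZ LP).
have He := IH e x; have Hd := IH d x.
have := pf_cauchy_schwarz LP (fun y => noise r s e y ^+ 2) (fun y => noise r s d y ^+ 2).
rewrite (_ : (fun y => (noise r s e y ^+ 2) ^+ 2) = fun y => noise r s e y ^+ 4); last first.
  by apply/funext => y; rewrite -exprM.
rewrite (_ : (fun y => (noise r s d y ^+ 2) ^+ 2) = fun y => noise r s d y ^+ 4); last first.
  by apply/funext => y; rewrite -exprM.
have X0 : 0 <= noise 0 s (fun y => e y ^+ 2) x by apply: noise_ge0 => // y; exact: sqr_ge0.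
have Y0 : 0 <= noise 0 s (fun y => d y ^+ 2) x by apply: noise_ge0 => // y; exact: sqr_ge0.
have P0 : 0 <= noise 0 s (fun y => noise r s e y ^+ 4) x.
  by apply: noise_ge0 => // y; rewrite (exprM _ 2 2) sqr_ge0.
have Q0 : 0 <= noise 0 s (fun y => noise r s d y ^+ 4) x.
  by apply: noise_ge0 => // y; rewrite (exprM _ 2 2) sqr_ge0.
move: (noise 0 s (fun y => noise r s e y ^+ 2 * _) x) => Z.
move: (noise 0 s (fun y => e y ^+ 2) x) (noise 0 s (fun y => d y ^+ 2) x) He Hd X0 Y0.
move: (noise 0 s (fun y => noise r s e y ^+ 4) x)
  (noise 0 s (fun y => noise r s d y ^+ 4) x) P0 Q0.
move=> P Q P0 Q0 X Y HP HQ X0 Y0 HZ.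
have {}HZ : Z <= X * Y.
  apply: (le_trans (ler_norm _)).
  rewrite -(@ler_pXn2r _ 2) ?nnegrE ?mulr_ge0// real_normK ?num_real//.
  by apply: (le_trans HZ); rewrite exprMn ler_pM.
have := sqr_ge0 Y; lra.
Qed.

End Cube.

(** * Isoperimetry without logarithm *)

Section CubeInequalities.
Variables (R : realType) (n : nat).
Implicit Types (x y : cube n) (i : 'I_n) (s : seq 'I_n) (S J : {set 'I_n}).
Implicit Types (f g q : cube n -> R).
Local Notation full := (full n).
Local Notation expect_pos := (expect_pos R n).

Definition indicator q := forall y, q y = 0 \/ q y = 1.

Definition sens q i x : bool := q x != q (flip i x).

Let ne01 : (0 == 1 :> R) = false. Proof. by rewrite eq_sym oner_eq0. Qed.

(** Induction on the averaged coordinates. Adding coordinate [i] adds to the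
sensitivity under the square root the indicator of crossing the boundary in
direction [i]; by Minkowski the two contributions combine as the legs of a right
triangle, at the endpoint of the edge with the larger average. With [b >= c]
the averages at the two endpoints, the hypotenuse is at least
[b - b^2 + (b - c)^2 / 2], and half of the last term is what is needed, because
[t - t^2] at the midpoint of [b] and [c] exceeds the mean of its values at [b]
and [c] by [(b - c)^2 / 4]. *)
Lemma isoperimetry_pointwise q s x : indicator q ->
  noise 0 s q x - noise 0 s q x ^+ 2 <=
  noise 0 s (fun y => q y * Num.sqrt (count (fun i => sens q i y) s)%:R) x.
Proof.
move=> q01; have z01 : 0 <= (0 : R) <= 1 by rewrite lexx ler01.
elim: s x => [|i s IH] x.
  rewrite /noise /= sqrtr0 mulr0.
  by case: (q01 x) => ->; rewrite ?expr0n ?expr1n /=; lra.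
set a := noise 0 s q; pose h y := (count (fun i => sens q i y) s)%:R : R.
pose P := noise 0 s
  (fun y => q y * Num.sqrt (count (fun i => sens q i y) (i :: s))%:R).
have q_ge0 y : 0 <= q y by case: (q01 y) => ->.
have a01 y : 0 <= a y <= 1.
  rewrite /a noise_ge0//= -[leRHS](noise_cst 0 s 1 y).
  by apply: (pf_le (noise_pos s y z01)) => z; case: (q01 z) => ->; rewrite ?ler01.
have PE y : P y = noise 0 s (fun z => Num.sqrt
    ((q z * Num.sqrt (h z)) ^+ 2 + (q z * (sens q i z)%:R) ^+ 2)) y.
  congr (noise 0 s _ y); apply/funext => z /=.
  have -> : (q z * Num.sqrt (h z)) ^+ 2 + (q z * (sens q i z)%:R) ^+ 2 =
     q z ^+ 2 * (sens q i z + count (fun i => sens q i z) s)%:R.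
    rewrite !exprMn sqr_sqrtr ?ler0n// natrD /h.
    by case: (sens q i z) => /=; rewrite ?expr0n ?expr1n /=; ring.
  by rewrite sqrtrM ?sqr_ge0// sqrtr_sqr ger0_norm.
have P0 y : 0 <= P y.
  by apply: noise_ge0 => // z; rewrite mulr_ge0 ?sqrtr_ge0.
have Pge y : a y - a y ^+ 2 <= P y.
  apply: (le_trans (IH y)); apply: (pf_le (noise_pos s y z01)) => z.
  by apply: ler_wpM2l => //; rewrite ler_wsqrtr// ler_nat leq_addl.
have Pgain y : a (flip i y) <= a y ->
    a y - a y ^+ 2 + (a y - a (flip i y)) ^+ 2 / 2 <= P y.
  move=> ale.
  have := pf_minkowski (noise_pos s y z01) (fun z => q z * Num.sqrt (h z))
                       (fun z => q z * (sens q i z)%:R).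
  rewrite -PE; have := IH y; rewrite -/a -/(h _).
  move: (noise 0 s (fun z => q z * Num.sqrt _) y) => U hU.
  have : a y - a (flip i y) <= noise 0 s (fun z => q z * (sens q i z)%:R) y.
    rewrite /a -noise_flip -(pfB (noise_pos s y z01)).
    apply: (pf_le (noise_pos s y z01)) => z; rewrite /sens.
    by case: (q01 z) => ->; case: (q01 (flip i z)) => -> /=;
      rewrite ?eqxx ?oner_eq0 ?ne01 /=; lra.
  move: (noise 0 s (fun z => q z * (sens q i z)%:R) y) => V hV hUV.
  have [/andP[b0 b1] /andP[c0 c1]] := (a01 y, a01 (flip i y)).
  move: (a y) (a (flip i y)) (P y) (P0 y) ale hU hV hUV b0 b1 c0 c1.
  move=> b c p p0 cb hU hV hUV b0 b1 c0 c1.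
  have X0 : 0 <= b - b ^+ 2 by rewrite expr2 -{1}[b]mulr1 -mulrBr mulr_ge0// subr_ge0.
  have Y0 : 0 <= b - c by rewrite subr_ge0.
  have hX : (b - b ^+ 2) ^+ 2 <= U ^+ 2 by rewrite ler_pXn2r ?nnegrE// (le_trans X0).
  have hY : (b - c) ^+ 2 <= V ^+ 2 by rewrite ler_pXn2r ?nnegrE// (le_trans Y0).
  have hp : (b - b ^+ 2) ^+ 2 + (b - c) ^+ 2 <= p ^+ 2.
    by apply: le_trans hUV; rewrite lerD.
  rewrite -(@ler_pXn2r _ 2) ?nnegrE//; last by rewrite addr_ge0// divr_ge0// sqr_ge0.
  apply: le_trans hp; set X := b - b ^+ 2 in X0 *; set Y := b - c in Y0 *.
  have X4 : X <= 1/4 by have := sqr_ge0 (b - 1/2); rewrite /X; lra.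
  have Y1 : Y ^+ 2 <= 1 by rewrite expr_le1// /Y; lra.
  (* [(X + Y^2/2)^2 <= X^2 + Y^2] amounts to [X + Y^2/4 <= 1] *)
  have h0 : 0 <= 1 - X - Y ^+ 2 / 4 by lra.
  have := mulr_ge0 (sqr_ge0 Y) h0; lra.
rewrite !noise_cons -/a -[noise 0 s (fun y => _)]/P /noise1.
have [le|/ltW le] := leP (a (flip i x)) (a x).
  have := Pgain x le; have := Pge (flip i x); lra.
have := Pgain (flip i x); rewrite flipK => /(_ le); have := Pge x; lra.
Qed.

(** * Bounds on the low Fourier levels *)

Lemma hypercontractivity r f : 0 <= r <= 1 -> r ^+ 2 = 1 / 3 ->
  expect (fun y => noise r full f y ^+ 4) <= expect (fun y => f y ^+ 2) ^+ 2.
Proof.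
move=> r01 r2; have := hypercontractivity_pointwise full f [ffun=> false] r01 r2.
by rewrite !noise0_full.
Qed.

Lemma expect_noise_sqr r f :
  expect (fun y => noise r full f y ^+ 2) =
  expect (fun y => f y * noise r full (noise r full f) y).
Proof.
rewrite parseval_sqr parseval; apply: eq_bigr => S _.
rewrite !fourier_noise; ring.
Qed.

(** The dual (4/3, 2) form of hypercontractivity, with the norm of order 4/3
interpolated between the norms of order 1 and 2. With [v = T (T f)] one has
[E (T f)^2 = E (f * v)], and Cauchy-Schwarz with weight [|f|], then
Cauchy-Schwarz again, bring out the fourth moment of [v], which
hypercontractivity bounds by the square of [E (T f)^2]. *)
Lemma noise_L1_L2 r f : 0 <= r <= 1 -> r ^+ 2 = 1 / 3 ->
  expect (fun y => noise r full f y ^+ 2) ^+ 2 <=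
  expect (fun y => `|f y|) ^+ 2 * expect (fun y => f y ^+ 2).
Proof.
move=> r01 r2; set X := expect _; have X0 : 0 <= X.
  by apply: (pf_ge0 expect_pos) => y; exact: sqr_ge0.
pose v := noise r full (noise r full f).
set A := expect (fun y => `|f y|); set B := expect (fun y => f y ^+ 2).
have A0 : 0 <= A by apply: (pf_ge0 expect_pos) => y.
have B0 : 0 <= B by apply: (pf_ge0 expect_pos) => y; exact: sqr_ge0.
pose Z := expect (fun y => `|f y| * v y ^+ 2).
have XZ : X ^+ 2 <= A * Z.
  have : X <= expect (fun y => Num.sqrt `|f y| * (Num.sqrt `|f y| * `|v y|)).
    rewrite /X expect_noise_sqr; apply: (pf_le expect_pos) => y.
    by rewrite mulrA -expr2 sqr_sqrtr// -normrM ler_norm.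
  move=> XE; apply: (@le_trans _ _
    (expect (fun y => Num.sqrt `|f y| * (Num.sqrt `|f y| * `|v y|)) ^+ 2)).
    by rewrite ler_pXn2r ?nnegrE// (le_trans X0).
  apply: (le_trans (pf_cauchy_schwarz expect_pos _ _)).
  apply: ler_pM; rewrite ?(pf_ge0 expect_pos)//; try by move=> y; exact: sqr_ge0.
    by apply: (pf_le expect_pos) => y; rewrite sqr_sqrtr.
  apply: (pf_le expect_pos) => y; rewrite exprMn sqr_sqrtr//.
  by rewrite real_normK ?num_real.
have ZB : Z ^+ 2 <= B * X ^+ 2.
  apply: (le_trans (pf_cauchy_schwarz expect_pos _ _)).
  apply: ler_pM; rewrite ?(pf_ge0 expect_pos)//; try by move=> y; exact: sqr_ge0.
    by apply: (pf_le expect_pos) => y; rewrite real_normK ?num_real.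
  apply: le_trans (hypercontractivity (noise r full f) r01 r2).
  by apply: (pf_le expect_pos) => y; rewrite -exprM.
have Z0 : 0 <= Z by apply: (pf_ge0 expect_pos) => y; rewrite mulr_ge0 ?sqr_ge0.
have [->|X1] := eqVneq X 0; first by rewrite expr0n /= mulr_ge0 ?sqr_ge0.
have X2 : 0 < X ^+ 2 by rewrite exprn_gt0// lt_neqAle eq_sym X1.
rewrite -(ler_pM2r X2) -[leRHS]mulrA.
apply: (@le_trans _ _ ((A * Z) ^+ 2)).
  by rewrite -expr2 ler_pXn2r ?nnegrE ?sqr_ge0// mulr_ge0.
by rewrite exprMn ler_wpM2l ?sqr_ge0.
Qed.

Lemma expect_bool (b : cube n -> bool) : expect (fun y => (b y)%:R) = mu R [set y | b y].
Proof.
rewrite expectE /mu; congr (_ / _); rewrite -natr_sum; congr (_%:R).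
by rewrite -sum1_card [RHS]big_mkcond; apply: eq_bigr => y _; rewrite inE; case: (b y).
Qed.

(** The part of [q] that depends on coordinate [i], that is [q - E_i q]. *)
Definition halfdiff q i y : R := 1/2 * q y + (- (1/2)) * q (flip i y).

Lemma fourierZ a f S : fourier (fun y => a * f y) S = a * fourier f S.
Proof.
rewrite /fourier -(pfZ expect_pos); congr expect.
by apply/funext => y; rewrite mulrA.
Qed.

Lemma fourier_halfdiff q i S : fourier (halfdiff q i) S = (i \in S)%:R * fourier q S.
Proof.
rewrite /halfdiff fourier_lin fourierZ fourier_flip.
by case: (i \in S) => /=; rewrite ?expr1 ?expr0; lra.
Qed.

Lemma expect_halfdiff q i : indicator q ->
  expect (fun y => `|halfdiff q i y|) = influence q i / 2.
Proof.
move=> q01; rewrite /influence -expect_bool mulrC -(pfZ expect_pos).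
congr expect; apply/funext => y; rewrite /halfdiff.
case: (q01 y) => ->; case: (q01 (flip i y)) => ->;
  rewrite ?eqxx ?oner_eq0 ?ne01 /= ?mulr0 ?mulr1 ?add0r ?addr0 ?subrr ?normr0//.
  by rewrite normrN ger0_norm; lra.
by rewrite ger0_norm; lra.
Qed.

Lemma expect_indicator_sqr q : indicator q -> expect (fun y => q y ^+ 2) = expect q.
Proof.
move=> q01; congr expect; apply/funext => y.
by case: (q01 y) => ->; rewrite ?expr0n ?expr1n.
Qed.

Lemma varianceE f : variance f = expect (fun y => f y ^+ 2) - expect f ^+ 2.
Proof.
rewrite /variance; set c := expect f.
transitivity (expect (fun y => (- (2 * c)) * f y + (f y ^+ 2 + c ^+ 2))).
  by congr expect; apply/funext => y; ring.
rewrite (pf_lin expect_pos) (pfD expect_pos) expect_cst -/c; ring.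
Qed.

Lemma variance_fourier f : variance f = \sum_(S | S != set0) fourier f S ^+ 2.
Proof.
by rewrite varianceE parseval_sqr (bigD1 set0)//= fourier_set0 addrAC subrr add0r.
Qed.

Lemma variance_ge0 f : 0 <= variance f.
Proof.
by rewrite variance_fourier; apply: sumr_ge0 => S _; exact: sqr_ge0.
Qed.

Let r : R := Num.sqrt (1 / 3).
Let r2 : r ^+ 2 = 1 / 3. Proof. by rewrite sqr_sqrtr//; lra. Qed.
Let r01 : 0 <= r <= 1.
Proof.
rewrite sqrtr_ge0 /= -(@ler_pXn2r _ 2) ?nnegrE ?sqrtr_ge0// r2 expr1n; lra.
Qed.

Lemma noise_sqr_fourier f :
  expect (fun y => noise r full f y ^+ 2) =
  \sum_(S : {set 'I_n}) (1/3) ^+ #|S| * fourier f S ^+ 2.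
Proof.
rewrite parseval_sqr; apply: eq_bigr => S _.
by rewrite fourier_noise count_full exprMn -r2 -!exprM mulnC.
Qed.

(** An indicator of small mean has little Fourier mass at low levels: for it the
mean, the mean absolute value and the second moment coincide. *)
Lemma small_set_levels q : indicator q ->
  (\sum_(S : {set 'I_n}) (1/3) ^+ #|S| * fourier q S ^+ 2) ^+ 2 <= expect q ^+ 3.
Proof.
move=> q01; rewrite -noise_sqr_fourier; apply: (le_trans (noise_L1_L2 _ r01 r2)).
rewrite expect_indicator_sqr//.
rewrite (_ : (fun y => `|q y|) = q); first by rewrite -exprSr.
by apply/funext => y; case: (q01 y) => ->; rewrite ?normr0 ?normr1.
Qed.

Lemma influence_ge0 q i : 0 <= influence q i.
Proof. by rewrite /influence /mu divr_ge0. Qed.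

(** Small influences force the Fourier mass to high levels. The functions
[g i = T (q - E_i q)] have coefficients [3^(-|S|/2)] times those of [q] on the
sets [S] containing [i]; summing the second moments over [i] thus gives level
[k] the weight [k / 3^k <= 1], whereas without the noise it would be [k], and
the sum would be of the order of the total influence. Noise does not increase
[E |q - E_i q|], and Cauchy-Schwarz over [i] separates the influences from the
second moments. *)
Lemma low_influence_levels q : indicator q ->
  (\sum_(S : {set 'I_n}) #|S|%:R * (1/9) ^+ #|S| * fourier q S ^+ 2) ^+ 2 <=
  (\sum_(i < n) influence q i ^+ 2) * variance q.
Proof.
move=> q01; pose g i := noise r full (halfdiff q i).
pose A i := expect (fun y => `|g i y|); pose B i := expect (fun y => g i y ^+ 2).
have A0 i : 0 <= A i by apply: (pf_ge0 expect_pos) => y.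
have B0 i : 0 <= B i by apply: (pf_ge0 expect_pos) => y; exact: sqr_ge0.
have coefg i S : fourier (g i) S ^+ 2 = (i \in S)%:R * (1/3) ^+ #|S| * fourier q S ^+ 2.
  rewrite /g fourier_noise count_full fourier_halfdiff.
  rewrite exprMn [(_%:R * _) ^+ 2]exprMn -r2 -!exprM mulnC.
  by case: (i \in S) => /=; rewrite ?expr0n ?expr1n /=; ring.
have sum_in S (c : R) : \sum_(i < n) (i \in S)%:R * c = #|S|%:R * c.
  rewrite -mulr_suml -natr_sum -sum1_card [in RHS]big_mkcond.
    by congr (_%:R * _); apply: eq_bigr => i _; case: (i \in S).
have -> : \sum_(S : {set 'I_n}) #|S|%:R * (1/9) ^+ #|S| * fourier q S ^+ 2 =
    \sum_(i < n) expect (fun y => noise r full (g i) y ^+ 2).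
  under [RHS]eq_bigr do rewrite noise_sqr_fourier.
  rewrite exchange_big; apply: eq_bigr => S _.
  under eq_bigr do rewrite coefg mulrCA -!mulrA.
  rewrite sum_in -!mulrA; congr (_ * _); rewrite mulrA -exprMn; congr (_ ^+ _ * _).
  lra.
have hB : \sum_i B i <= variance q.
  rewrite variance_fourier; under eq_bigr do rewrite /B parseval_sqr.
  rewrite exchange_big /= (bigD1 set0)//= big1 ?add0r => [|i _]; last first.
    by rewrite coefg inE !mul0r.
  apply: ler_sum => S S0; under eq_bigr do rewrite coefg -mulrA.
  rewrite sum_in mulrA ler_piMl ?sqr_ge0// mul1r exprVn ler_pdivrMr ?exprn_gt0//.
  by rewrite mul1r -natrX ler_nat ltnW// ltn_expl.
have hA i : A i <= influence q i.
  apply: (@le_trans _ _ (expect (fun y => `|halfdiff q i y|))).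
    rewrite -[leRHS](noise_expect r full); apply: (pf_le expect_pos) => y.
    have NP := noise_pos full y r01.
    rewrite ler_norml; apply/andP; split; last first.
      by apply: (pf_le NP) => z; exact: ler_norm.
    rewrite -mulN1r -(pfZ NP); apply: (pf_le NP) => z.
    by rewrite mulN1r lerNl -normrN ler_norm.
  by rewrite expect_halfdiff//; have := influence_ge0 q i; lra.
apply: (@le_trans _ _ ((\sum_i A i * Num.sqrt (B i)) ^+ 2)).
  have C0 i : 0 <= expect (fun y => noise r full (g i) y ^+ 2).
    by apply: (pf_ge0 expect_pos) => y; exact: sqr_ge0.
  rewrite ler_pXn2r ?nnegrE ?sumr_ge0// => [|i _]; last first.
    by rewrite mulr_ge0 ?sqrtr_ge0.
  apply: ler_sum => i _.
  rewrite -(@ler_pXn2r _ 2) ?nnegrE ?mulr_ge0 ?sqrtr_ge0//.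
  by rewrite exprMn sqr_sqrtr//; exact: noise_L1_L2.
have := pf_cauchy_schwarz (sum_positive_functional (fun _ : 'I_n => ler01 : 0 <= (1 : R)))
   A (fun i => Num.sqrt (B i)).
rewrite (eq_bigr (fun i => A i * Num.sqrt (B i))) => [|i _]; last by rewrite mul1r.
move=> /le_trans; apply.
apply: ler_pM; rewrite ?sumr_ge0//; try by move=> i _; rewrite mul1r sqr_ge0.
  by apply: ler_sum => i _; rewrite mul1r ler_pXn2r ?nnegrE ?influence_ge0.
by under eq_bigr do rewrite mul1r sqr_sqrtr//.
Qed.

(** * Random restrictions *)

(** The probability of [J] when each coordinate is in [J] with probability [d]. *)
Definition weight (d : R) J : R := \prod_i (if i \in J then d else 1 - d).

Lemma sum_weight d : \sum_J weight d J = 1.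
Proof. by rewrite sum_subset_prod big1// => i _; lra. Qed.

(** Probability that [J] misses [S]. The power of 0 is the factor by which
averaging over the coordinates in [J] multiplies the Fourier coefficient at [S]. *)
Lemma sum_weight_avoid d S :
  \sum_J weight d J * 0 ^+ count [in S] (enum J) = (1 - d) ^+ #|S|.
Proof.
transitivity (\sum_(J : {set 'I_n})
    \prod_i (if i \in J then d * 0 ^+ (i \in S) else 1 - d)).
  apply: eq_bigr => J _; rewrite /weight.
  have -> : 0 ^+ count [in S] (enum J) = \prod_(i in J) 0 ^+ (i \in S) :> R.
    rewrite -big_enum /=; elim: (enum J) => [|i s IH]; rewrite ?big_nil//=.
    by rewrite big_cons exprD IH.
  rewrite [X in _ * X]big_mkcond -big_split; apply: eq_bigr => i _ /=.
  by case: (i \in J); rewrite ?mulr1.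
rewrite sum_subset_prod -prodr_const [RHS]big_mkcond; apply: eq_bigr => i _.
by case: (i \in S); rewrite /= ?expr1 ?expr0; lra.
Qed.

Lemma sum_weight_mem d i : \sum_J weight d J * (i \in J)%:R = d.
Proof.
have := sum_weight_avoid d [set i].
rewrite cards1 expr1 => h; rewrite -[RHS](subKr 1) -h -[X in _ = X - _](sum_weight d) -sumrB.
apply: eq_bigr => J _; rewrite -[X in _ = X - _]mulr1 -mulrBr; congr (_ * _).
rewrite (eq_count (a2 := pred1 i)) => [|j]; last by rewrite /= inE.
rewrite count_uniq_mem ?enum_uniq// mem_enum.
by case: (i \in J) => /=; rewrite ?expr1 ?expr0; lra.
Qed.

Lemma weight_ge0 d J : 0 <= d <= 1 -> 0 <= weight d J.
Proof.
move=> /andP[d0 d1]; apply: prodr_ge0 => i _.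
by case: ifP => // _; rewrite subr_ge0.
Qed.

Lemma sensitivityE q y :
  (sensitivity q y)%:R = \sum_(i < n) (sens q i y)%:R :> R.
Proof.
rewrite /sensitivity -natr_sum -sum1_card big_mkcond; congr (_%:R).
by apply: eq_bigr => i _; rewrite inE /sens; case: (_ != _).
Qed.

(** Jensen's inequality: a random [J] contains on average [d * h] sensitive
coordinates. *)
Lemma expected_sqrt_count d q y : 0 <= d <= 1 ->
  \sum_J weight d J * Num.sqrt (count (fun i => sens q i y) (enum J))%:R <=
  Num.sqrt d * Num.sqrt (sensitivity q y)%:R.
Proof.
move=> d01; have /andP[d0 d1] := d01.
have WP := sum_positive_functional (fun J => weight_ge0 J d01).
have := pf_cauchy_schwarz WP (fun=> 1)
  (fun J => Num.sqrt (count (fun i => sens q i y) (enum J))%:R).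
rewrite (eq_bigr (fun J => weight d J * Num.sqrt (count (fun i => sens q i y) (enum J))%:R))
  => [|J _]; last by rewrite mul1r.
under [X in _ <= X * _]eq_bigr do rewrite expr1n mulr1.
under [X in _ <= _ * X]eq_bigr do rewrite sqr_sqrtr//.
rewrite sum_weight mul1r.
have -> : \sum_J weight d J * (count (fun i => sens q i y) (enum J))%:R =
    d * (sensitivity q y)%:R.
  rewrite sensitivityE mulr_sumr.
  transitivity (\sum_J \sum_(i < n) weight d J * (i \in J)%:R * (sens q i y)%:R).
    apply: eq_bigr => J _; rewrite -sum1_count big_enum_cond /= natr_sum.
    rewrite big_mkcond mulr_sumr; apply: eq_bigr => i _.
    by case: (i \in J); case: (sens q i y); rewrite ?mulr1 ?mulr0.
  rewrite exchange_big; apply: eq_bigr => i _ /=.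
  by rewrite -mulr_suml sum_weight_mem.
move=> h; rewrite -sqrtrM// -[leLHS]ger0_norm; last first.
  by apply: sumr_ge0 => J _; rewrite mulr_ge0 ?weight_ge0 ?sqrtr_ge0.
by rewrite -sqrtr_sqr ler_wsqrtr.
Qed.

(** The left side is the mean over restrictions of the variance of [q] with
only the coordinates in [J] left free. *)
Lemma restriction_isoperimetry q J : indicator q ->
  \sum_(S : {set 'I_n}) (1 - 0 ^+ count [in S] (enum J)) * fourier q S ^+ 2 <=
  expect (fun y => q y * Num.sqrt (count (fun i => sens q i y) (enum J))%:R).
Proof.
move=> q01; rewrite -(noise_expect 0 (enum J)).
apply: le_trans (pf_le expect_pos (fun y => isoperimetry_pointwise (enum J) y q01)).
rewrite (pfB expect_pos) noise_expect -expect_indicator_sqr// !parseval_sqr -sumrB.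
apply: ler_sum => S _; rewrite fourier_noise exprMn mulrBl mul1r.
by case: (count _ _) => [|k]; rewrite ?expr0n ?expr1n.
Qed.

(** Restrictions to few free coordinates lose a factor [sqrt d] of boundary but
keep the variance of all levels above [1 / d]. *)
Lemma random_restriction d q : indicator q -> 0 <= d <= 1 ->
  \sum_(S : {set 'I_n}) (1 - (1 - d) ^+ #|S|) * fourier q S ^+ 2 <=
  Num.sqrt d * expect (fun y => q y * Num.sqrt (sensitivity q y)%:R).
Proof.
move=> q01 d01.
have -> : \sum_(S : {set 'I_n}) (1 - (1 - d) ^+ #|S|) * fourier q S ^+ 2 =
  \sum_J weight d J *
     \sum_(S : {set 'I_n}) (1 - 0 ^+ count [in S] (enum J)) * fourier q S ^+ 2.
  under [RHS]eq_bigr do rewrite mulr_sumr.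
  rewrite exchange_big; apply: eq_bigr => S _ /=.
  under eq_bigr do rewrite mulrA mulrBr mulr1.
  by rewrite -mulr_suml sumrB sum_weight sum_weight_avoid.
apply: (@le_trans _ _ (\sum_J weight d J *
  expect (fun y => q y * Num.sqrt (count (fun i => sens q i y) (enum J))%:R))).
  by apply: ler_sum => J _; rewrite ler_wpM2l ?weight_ge0// restriction_isoperimetry.
rewrite -(pfZ expect_pos).
rewrite /expect; under eq_bigr do rewrite mulr_sumr.
rewrite exchange_big; apply: ler_sum => y _ /=.
apply: (@le_trans _ _ (mu R [set y] * (q y * \sum_J weight d J *
   Num.sqrt (count (fun i => sens q i y) (enum J))%:R))).
  rewrite mulr_sumr mulr_sumr le_eqVlt; apply/orP; left; apply/eqP.
  by apply: eq_bigr => J _; ring.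
rewrite ler_wpM2l ?divr_ge0// mulrCA ler_wpM2l ?expected_sqrt_count//.
by case: (q01 y) => ->.
Qed.

(** * Splitting the variance between high and low levels *)

Lemma geometric_decay (t : R) k : 0 <= t <= 1 -> (1 - t) ^+ k * (1 + k%:R * t) <= 1.
Proof.
move=> /andP[t0 t1]; elim: k => [|k IH]; first by rewrite expr0 mul0r; lra.
apply: le_trans IH; rewrite exprSr -mulrA ler_wpM2l ?exprn_ge0 ?subr_ge0//.
have := mulr_ge0 (mulr_ge0 (ler0n R k) t0) t0.
have := sqr_ge0 t; rewrite -natr1; move: (k%:R : R) => c; lra.
Qed.

Lemma high_levels (d k : nat) : (0 < d)%N -> (d <= k)%N ->
  1 <= 2 * (1 - (1 - d%:R^-1) ^+ k) :> R.
Proof.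
move=> d0 dk; set t : R := d%:R^-1.
have dp : 0 < d%:R :> R by rewrite ltr0n.
have t0 : 0 <= t by rewrite invr_ge0 ltW.
have t1 : t <= 1 by rewrite invf_le1// ler1n.
have := @geometric_decay t k; rewrite t0 t1 => /(_ isT).
have kt : 1 <= k%:R * t by rewrite ler_pdivlMr// mul1r ler_nat.
have : 0 <= (1 - t) ^+ k by rewrite exprn_ge0 ?subr_ge0.
move: ((1 - t) ^+ k) (k%:R * t) kt => X c kt X0 h.
have : X * 1 <= X * c by rewrite ler_wpM2l.
lra.
Qed.

(** A nonempty level is paid for by the random restriction with [1 / d] if it is
at least [d], and by the weight [w] otherwise. *)
Lemma variance_le_levels q (d : nat) (w : nat -> R) : indicator q -> (0 < d)%N ->
  (forall k, 0 <= w k) -> (forall k, (0 < k < d)%N -> 1 <= w k) ->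
  variance q <=
  2 * (Num.sqrt d%:R^-1 * expect (fun y => q y * Num.sqrt (sensitivity q y)%:R))
  + \sum_(S : {set 'I_n}) w #|S| * fourier q S ^+ 2.
Proof.
move=> q01 d0 w0 w1.
have dp : 0 < d%:R :> R by rewrite ltr0n.
have t01 : 0 <= (d%:R^-1 : R) <= 1 by rewrite invr_ge0 ltW//= invf_le1// ler1n.
have /andP[t0 t1] := t01.
apply: le_trans (lerD (ler_wpM2l (ler0n R 2) (random_restriction q01 t01)) (lexx _)).
rewrite mulr_sumr -big_split variance_fourier big_mkcond; apply: ler_sum => S _ /=.
rewrite mulrA -mulrDl.
have P0 : 0 <= 1 - (1 - d%:R^-1) ^+ #|S| :> R.
  by rewrite subr_ge0 exprn_ile1// ?subr_ge0// lerBlDr lerDl.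
have [_|S0] := eqVneq S set0.
  by rewrite /= mulr_ge0 ?sqr_ge0// addr_ge0// mulr_ge0.
rewrite /= ler_peMl ?sqr_ge0//.
have [dS|Sd] := leqP d #|S|.
  by have := high_levels d0 dS; have := w0 #|S|; lra.
have := w1 #|S|; rewrite card_gt0 S0 Sd => /(_ isT) h; lra.
Qed.

Lemma variance_indicator q : indicator q -> variance q = expect q * (1 - expect q).
Proof. by move=> q01; rewrite varianceE expect_indicator_sqr//; ring. Qed.

Lemma expect_indicator01 q : indicator q -> 0 <= expect q <= 1.
Proof.
move=> q01; rewrite (pf_ge0 expect_pos) => [|y]; last by case: (q01 y) => ->.
rewrite -[leRHS](@expect_cst R n); apply: (pf_le expect_pos) => y.
by case: (q01 y) => ->; rewrite ?ler01.
Qed.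

(** The condition on [d] makes the Fourier mass below level [d] at most
[variance q / 2]. If [E q <= sqrt W], the smallness of the set is used; otherwise
the smallness of the influences, together with [sqrt W < E q <= 2 * variance q]. *)
Lemma sqrt_sensitivity_ge q (d : nat) : indicator q -> expect q <= 1 / 2 -> (0 < d)%N ->
  16 * 81 ^+ d * Num.sqrt (\sum_(i < n) influence q i ^+ 2) <= 1 ->
  variance q * Num.sqrt d%:R <=
  4 * expect (fun y => q y * Num.sqrt (sensitivity q y)%:R).
Proof.
move=> q01 a2 d0; set W := \sum_(i < n) _; set m := expect (fun y => _).
move=> hW.
have W0 : 0 <= W by apply: sumr_ge0 => i _; exact: sqr_ge0.
have /andP[a0 a1] := expect_indicator01 q01.
have vE := variance_indicator q01.
have v0 : 0 <= variance q by rewrite vE mulr_ge0// subr_ge0.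
have va : expect q / 2 <= variance q by rewrite vE; nra.
have av : variance q <= expect q by rewrite vE; nra.
suff h : variance q <= 2 * (Num.sqrt d%:R^-1 * m) + variance q / 2.
  have s0 : 0 < Num.sqrt d%:R :> R by rewrite sqrtr_gt0 ltr0n.
  rewrite sqrtrV ?ler0n// in h.
  rewrite -ler_pdivlMr// -mulrA [m / _]mulrC; lra.
have [aW|Wa] := leP (expect q) (Num.sqrt W).
- have hw k : 0 <= (3 ^+ d * (1/3) ^+ k : R) by rewrite mulr_ge0 ?exprn_ge0//; lra.
  have := variance_le_levels q01 d0 hw; move=> /(_ _)/le_trans; apply.
    move=> k /andP[_ kd]; rewrite mul1r exprVn ler_pdivlMr ?exprn_gt0// mul1r.
    by rewrite ler_weXn2l ?ler1n// ltnW.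
  rewrite lerD2l; under eq_bigr do rewrite -mulrA.
  rewrite -mulr_sumr; have := small_set_levels q01.
  set K := \sum_(S : {set 'I_n}) _ => hK.
  have K0 : 0 <= K.
    by apply: sumr_ge0 => S _; rewrite mulr_ge0 ?sqr_ge0// exprn_ge0//; lra.
  apply: (@le_trans _ _ (expect q / 4)); last by lra.
  rewrite -(@ler_pXn2r _ 2) ?nnegrE ?divr_ge0 ?mulr_ge0 ?exprn_ge0//.
  rewrite exprMn -exprM mulnC exprM (_ : 3 ^+ 2 = 9); last by lra.
  have h9 : 16 * 9 ^+ d * expect q <= 1.
    apply: le_trans hW; apply: ler_pM => //; first by rewrite mulr_ge0 ?exprn_ge0.
    rewrite ler_wpM2l// ler_pXn2r ?nnegrE//; lra.
  have e0 : 0 <= (9 ^+ d : R) by rewrite exprn_ge0.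
  move: (9 ^+ d : R) h9 e0 => X h9 e0.
  apply: (@le_trans _ _ (X * expect q ^+ 3)); first by rewrite ler_wpM2l.
  have := mulr_ge0 (sqr_ge0 (expect q)) (_ : 0 <= 1 - 16 * X * expect q).
  rewrite subr_ge0 => /(_ h9); lra.
- have hk k : 0 <= (9 ^+ d * (k%:R * (1/9) ^+ k) : R).
    by rewrite !mulr_ge0 ?exprn_ge0//; lra.
  have := variance_le_levels q01 d0 hk; move=> /(_ _)/le_trans; apply.
    move=> k /andP[k0 kd]; rewrite mulrCA -[leLHS]mul1r ler_pM// ?ler1n//.
    rewrite mul1r exprVn ler_pdivlMr ?exprn_gt0// mul1r.
    by rewrite ler_weXn2l ?ler1n// ltnW.
  rewrite lerD2l; under eq_bigr do rewrite -mulrA.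
  rewrite -mulr_sumr; have := low_influence_levels q01; rewrite -/W.
  set K := \sum_(S : {set 'I_n}) _ => hK.
  have K0 : 0 <= K.
    by apply: sumr_ge0 => S _; rewrite mulr_ge0 ?sqr_ge0// mulr_ge0// exprn_ge0//; lra.
  have wE : Num.sqrt W ^+ 2 = W by rewrite sqr_sqrtr.
  have w0 := sqrtr_ge0 W; rewrite -wE in hK.
  clear wE; move: (Num.sqrt W) w0 hK hW Wa => w w0 hK hW Wa.
  rewrite -(@ler_pXn2r _ 2) ?nnegrE ?divr_ge0 ?mulr_ge0 ?exprn_ge0//.
  rewrite exprMn -exprM mulnC exprM (_ : 9 ^+ 2 = 81); last by lra.
  have e0 : 0 <= (81 ^+ d : R) by rewrite exprn_ge0.
  move: (81 ^+ d : R) hW e0 => X hW e0.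
  apply: (@le_trans _ _ (X * (w ^+ 2 * variance q))); first by rewrite ler_wpM2l.
  have h1 : X * w * w <= 1/16 * (2 * variance q).
    by apply: ler_pM; rewrite ?mulr_ge0//; lra.
  have := ler_wpM2r v0 h1; have := sqr_ge0 (variance q); lra.
Qed.

End CubeInequalities.

(** * The logarithmic factor and the change of exponent *)

Section Scale.
Variable R : realType.

Definition log_factor (W : R) : R := ln (2 + expR 1 / W).

Lemma log_factor_gt0 (W : R) : 0 <= W -> 0 < log_factor W.
Proof.
move=> W0; apply: ln_gt0; have : 0 <= expR 1 / W by rewrite divr_ge0 ?expR_ge0.
lra.
Qed.

Lemma expR1_ge2 : 2 <= expR 1 :> R.
Proof. by have := expR_ge1Dx (1 : R); lra. Qed.

Lemma log_factor_le (w : R) (d : nat) : 0 <= w -> 1 < 16 * 81 ^+ d.+1 * w ->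
  log_factor (w ^+ 2) <= 14 * d%:R + 36.
Proof.
move=> w0 hw.
have wp : 0 < w.
  by rewrite lt_neqAle w0 andbT eq_sym; apply: contraTneq hw => ->; rewrite mulr0 ltr10.
have e2 := expR1_ge2.
set E : R := 81 ^+ (2 * d + 4).
have E1 : 1 <= E by rewrite exprn_ege1//; lra.
have hE : (w ^+ 2)^-1 <= E.
  rewrite -[leLHS]mul1r ler_pdivrMr ?exprn_gt0//.
  have -> : E = (81 ^+ d.+2) ^+ 2 by rewrite -exprM /E; congr (_ ^+ _); lia.
  rewrite -exprMn exprn_ege1// (le_trans (ltW hw))// ler_wpM2r//.
  by rewrite [leRHS]exprS ler_wpM2r ?exprn_ge0//; lra.
have e81 : 81 <= expR 1 ^+ 7 :> R.
  by apply: (@le_trans _ _ (2 ^+ 7)); [lra | rewrite ler_pXn2r ?nnegrE ?expR_ge0].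
have hL : 2 + expR 1 / w ^+ 2 <= expR (14 * d%:R + 36).
  apply: (@le_trans _ _ (expR 1 * (81 * E))).
    have := ler_wpM2l (expR_ge0 1) hE; have := ler_wpM2l (expR_ge0 1) E1; lra.
  have -> : 14 * d%:R + 36 = 1 + (7 * (2 * d + 5))%N%:R * 1 :> R.
    rewrite natrM natrD natrM; lra.
  rewrite expRD expRM_natl ler_wpM2l ?expR_ge0// exprM /E -exprS.
  rewrite (_ : (2 * d + 4).+1 = (2 * d + 5)%N); last by lia.
  by rewrite lerXn2r ?nnegrE ?exprn_ge0 ?expR_ge0.
rewrite -[leRHS]expRK /log_factor ler_ln ?posrE ?expR_gt0//.
by rewrite ltr_pwDl ?divr_ge0 ?expR_ge0 ?sqr_ge0.
Qed.

(** The largest admissible level in [sqrt_sensitivity_ge], or 0 if there is none,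
is at least a fixed multiple of the logarithmic factor, up to an additive
constant. *)
Lemma log_factor_scale (W : R) : 0 <= W ->
  exists2 d : nat, log_factor W <= 14 * d%:R + 36 &
    d = 0%N \/ 16 * 81 ^+ d * Num.sqrt W <= 1.
Proof.
move=> W0; have [->|Wn0] := eqVneq W 0.
  exists 0%N; last by left.
  (* [e / 0 = 0], so the factor is [ln 2] *)
  rewrite /log_factor invr0 mulr0 addr0 mulr0 add0r -[leRHS]expRK.
  rewrite ler_ln ?posrE ?expR_gt0//; have := expR_ge1Dx (36 : R); lra.
set w := Num.sqrt W; have w0 : 0 < w.
  by rewrite sqrtr_gt0 lt_neqAle eq_sym Wn0.
have ex : exists d, 1 < 16 * 81 ^+ d.+1 * w.
  have [N hN] : exists N : nat, w^-1 < N%:R.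
    exists (Num.bound w^-1); apply: archi_boundP; by rewrite invr_ge0 ltW.
  exists N; rewrite -ltr_pdivrMr// mul1r; apply: (lt_le_trans hN).
  have : N%:R <= 81 ^+ N :> R by rewrite -natrX ler_nat ltnW// ltn_expl.
  rewrite exprS; have : 0 <= 81 ^+ N :> R by rewrite exprn_ge0.
  move: (81 ^+ N) => X; lra.
have hd := ex_minnP ex; move: hd => [d hd dmin].
exists d; first by rewrite -[W]sqr_sqrtr// log_factor_le// ltW.
case: d hd dmin => [|d] _ dmin; first by left.
right; rewrite leNgt; apply/negP => /dmin; lia.
Qed.

(** Reduces an exponent [p >= 1/2] to the exponent [1/2]: up to the level [l] the
left side is nonpositive, above it [t^(p - 1/2)] is at least [l^(p - 1/2)]. *)
Lemma powR_ge_sqrt (p t l : R) : 1 / 2 <= p -> 0 < l -> 0 <= t ->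
  l `^ (p - 1 / 2) * (Num.sqrt t - Num.sqrt l) <= t `^ p.
Proof.
move=> hp l0 t0; have [tl|lt] := leP t l.
  apply: (@le_trans _ _ 0); last exact: powR_ge0.
  by rewrite mulr_ge0_le0 ?powR_ge0// subr_le0 ler_wsqrtr.
have tp := lt_trans l0 lt.
apply: (@le_trans _ _ (l `^ (p - 1 / 2) * Num.sqrt t)).
  by rewrite ler_wpM2l ?powR_ge0// gerBl sqrtr_ge0.
have -> : t `^ p = t `^ (p - 1 / 2) * Num.sqrt t.
  rewrite -powR12_sqrt// -powRD; first by congr (_ `^ _); lra.
  by rewrite (gt_eqF tp) implybT.
rewrite ler_wpM2r ?sqrtr_ge0// ge0_ler_powR ?nnegrE ?subr_ge0// ltW//.
Qed.

End Scale.

(** * One-sided inequalities for the smaller side *)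

Section OneSided.
Variables (R : realType) (n : nat) (q : cube n -> R).
Hypothesis q01 : indicator q.
Hypothesis q_half : expect q <= 1 / 2.

Let L := log_factor (\sum_(i < n) influence q i ^+ 2).

Let W_ge0 : 0 <= \sum_(i < n) influence q i ^+ 2.
Proof. by apply: sumr_ge0 => i _; exact: sqr_ge0. Qed.

(** Serves when the logarithmic factor is bounded by a constant. *)
Lemma sqrt_sensitivity_ge_variance :
  variance q <= expect (fun y => q y * Num.sqrt (sensitivity q y)%:R).
Proof.
have d01 : 0 <= (1 : R) <= 1 by rewrite ler01 lexx.
have := random_restriction q01 d01; rewrite sqrtr1 mul1r; apply: le_trans.
rewrite variance_fourier big_mkcond; apply: ler_sum => S _.
rewrite subrr expr0n cards_eq0; case: eqVneq => _ /=; first by rewrite subrr mul0r.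
by rewrite subr0 mul1r.
Qed.

Lemma one_sided_eldan_gross :
  variance q * Num.sqrt L <=
  32 * expect (fun y => q y * Num.sqrt (sensitivity q y)%:R).
Proof.
have [d Ld hd] := log_factor_scale W_ge0; rewrite -/L in Ld.
have v0 := variance_ge0 q; have vm := sqrt_sensitivity_ge_variance.
have [d0|d0] := posnP d.
  have s6 : Num.sqrt L <= 6.
    rewrite d0 in Ld; rewrite -[leRHS]ger0_norm// -sqrtr_sqr ler_wsqrtr//; lra.
  have := ler_wpM2l v0 s6; lra.
case: hd => [d00|hW]; first by rewrite d00 in d0.
have hm := sqrt_sensitivity_ge q01 q_half d0 hW.
have d1 : 1 <= d%:R :> R by rewrite ler1n.
have s8 : Num.sqrt L <= 8 * Num.sqrt d%:R.
  rewrite -[8]ger0_norm// -sqrtr_sqr -sqrtrM ?sqr_ge0// ler_wsqrtr//; lra.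
have := ler_wpM2l v0 s8; lra.
Qed.

(** Sensitivities below [k * L] contribute at most half of the lower bound for the
exponent [1/2], since [q] has mean at most [2 * variance q]. *)
Lemma one_sided_power (p : R) : 1 / 2 <= p -> p < 1 ->
  variance q * L `^ p <=
  2 ^+ 20 * expect (fun y => (sensitivity q y)%:R `^ p * q y).
Proof.
move=> hp p1; have L0 : 0 < L by apply: log_factor_gt0.
have v0 := variance_ge0 q; have /andP[a0 a1] := expect_indicator01 q01.
have av : expect q <= 2 * variance q.
  have h : 0 <= 1 / 2 - expect q by rewrite subr_ge0.
  by rewrite variance_indicator//; have := mulr_ge0 a0 h; lra.
(* [sqrt k = 1/128], a quarter of the constant [1/32] of the case [p = 1/2] *)
set k : R := (2 ^+ 14)^-1; have k0 : 0 < k by rewrite invr_gt0 exprn_gt0.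
have k1 : k <= 1 by rewrite invf_le1 ?exprn_gt0// exprn_ege1//; lra.
have kL0 : 0 < k * L by rewrite mulr_gt0.
have sk : Num.sqrt (k * L) = Num.sqrt L / 2 ^+ 7.
  rewrite sqrtrM ?(ltW k0)// mulrC; congr (_ * _).
  by rewrite /k (exprM 2 7 2) -exprVn sqrtr_sqr ger0_norm// invr_ge0 exprn_ge0.
set M := expect (fun y => (sensitivity q y)%:R `^ p * q y).
have hM : (k * L) `^ (p - 1 / 2) *
   (expect (fun y => q y * Num.sqrt (sensitivity q y)%:R)
      - Num.sqrt (k * L) * expect q) <= M.
  rewrite -(pfZ (expect_pos R n)) -(pfB (expect_pos R n)) -(pfZ (expect_pos R n)).
  apply: (pf_le (expect_pos R n)) => y.
  have := powR_ge_sqrt hp kL0 (ler0n R (sensitivity q y)).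
  move=> /(ler_wpM2r (_ : 0 <= q y)); case: (q01 y) => -> h.
    by rewrite !(mul0r, mulr0) subrr mulr0.
  by rewrite !mulr1 [1 * Num.sqrt _]mul1r; move: (h ler01); rewrite !mulr1.
have kp : k <= k `^ (p - 1 / 2).
  rewrite -[leLHS]powRr1 ?(ltW k0)// ger_powR ?k0 ?k1//; lra.
have Lp : L `^ p = L `^ (p - 1 / 2) * Num.sqrt L.
  rewrite -powR12_sqrt ?(ltW L0)// -powRD; first by congr (_ `^ _); lra.
  by rewrite (gt_eqF L0) implybT.
have hs := one_sided_eldan_gross.
set m := expect (fun y => q y * _) in hs hM.
have h1 : variance q * Num.sqrt L / 64 <= m - Num.sqrt (k * L) * expect q.
  rewrite sk; have := ler_wpM2l (sqrtr_ge0 L) av; lra.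
have h2 : (k * L `^ (p - 1 / 2)) * (variance q * Num.sqrt L / 64) <= M.
  apply: le_trans hM; apply: ler_pM => //.
  - by rewrite mulr_ge0 ?powR_ge0 ?ltW.
  - by rewrite divr_ge0// mulr_ge0 ?sqrtr_ge0.
  by rewrite powRM ?(ltW k0) ?(ltW L0)// ler_wpM2r ?powR_ge0.
rewrite Lp; move: h2.
rewrite (_ : k * L `^ (p - 1 / 2) * (variance q * Num.sqrt L / 64) =
  (variance q * (L `^ (p - 1 / 2) * Num.sqrt L)) / 2 ^+ 20); last by rewrite /k; field.
by rewrite ler_pdivrMr ?exprn_gt0// mulrC [M * _]mulrC.
Qed.

End OneSided.

(** The sign [s] is chosen so that [s * f] has nonpositive mean; then
[q = (1 + s * f) / 2] is the indicator of an event of probability at most 1/2,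
with the sensitivities and influences of [f] and a quarter of its variance. *)
Lemma eldan_gross_minority (R : realType) n (f : cube n -> R) (s : R) :
  (s = -1 \/ s = 1) -> (forall y, f y = -1 \/ f y = 1) -> 0 <= s * - expect f ->
  exists g : cube n -> R,
    (forall y, 0 <= g y <= 1) /\
    expect (fun y => g y ^+ 2) <= 2 * variance f /\
    forall p : R, 1 / 2 <= p -> p < 1 ->
      (2 ^+ 22)^-1 * variance f *
        (ln (2 + expR 1 / \sum_(i < n) influence f i ^+ 2)) `^ p
      <= expect (fun y => (sensitivity f y)%:R `^ p * g y).
Proof.
move=> hs f1 hf; have EP := expect_pos R n.
pose q y := s / 2 * f y + 1 / 2.
have q01 : indicator q.
  move=> y; rewrite /q; case: hs => ->; case: (f1 y) => fy; rewrite fy;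
    [right|left|left|right]; lra.
have sE : s ^+ 2 = 1 by case: hs => ->; rewrite ?sqrrN expr1n.
have Eq : expect q = s / 2 * expect f + 1 / 2.
  by rewrite (pf_lin EP) expect_cst.
have half : expect q <= 1 / 2 by rewrite Eq; lra.
have qf y z : (q y != q z) = (f y != f z).
  congr (~~ _); rewrite /q; apply/eqP/eqP => [h|->//].
  have h' : s * f y = s * f z by lra.
  by rewrite -[f y]mul1r -[f z]mul1r -sE expr2 -!mulrA h'.
have senE y : sensitivity q y = sensitivity f y.
  by rewrite /sensitivity; congr (#|pred_of_set _|); apply/setP => i; rewrite !inE qf.
have infE i : influence q i = influence f i.
  by rewrite /influence; congr (mu R _); apply/setP => y; rewrite !inE qf.
have vE : variance f = 4 * variance q.
  rewrite /variance -(pfZ EP); congr expect; apply/funext => y.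
  rewrite Eq /q; transitivity (s ^+ 2 * (f y - expect f) ^+ 2); last by field.
  by rewrite sE mul1r.
exists q; split; [|split].
- by move=> y; case: (q01 y) => ->; rewrite ?lexx ?ler01.
- have /andP[a0 _] := expect_indicator01 q01.
  rewrite expect_indicator_sqr// vE variance_indicator//; nra.
move=> p hp p1; have := one_sided_power q01 half hp p1.
rewrite /log_factor; under eq_bigr do rewrite infE.
rewrite (_ : (fun y => _ * q y) = fun y => (sensitivity f y)%:R `^ p * q y); last first.
  by apply/funext => y; rewrite senE.
rewrite vE => h; rewrite -!mulrA ler_pdivrMl ?exprn_gt0//.
move: h; move: (expect _) (variance q * _) => a b; lra.
Qed.

Theorem theorem4 (R : realType) :
  exists C : R, 0 < C /\
    forall (n : nat) (f : cube n -> R),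
      (1 <= n)%N ->
      (forall y, f y = -1 \/ f y = 1) ->
      ~ (exists c : R, forall y, f y = c) ->
      exists g : cube n -> R,
        (forall y, 0 <= g y <= 1) /\
        expect (fun y => g y ^+ 2) <= 2 * variance f /\
        forall p : R, 1 / 2 <= p -> p < 1 ->
          C * variance f *
            (ln (2 + expR 1 / \sum_(i < n) influence f i ^+ 2)) `^ p
          <= expect (fun y => (sensitivity f y)%:R `^ p * g y).
Proof.
exists (2 ^+ 22)^-1; split; first by rewrite invr_gt0 exprn_gt0.
move=> n f _ f1 _; have [f0|/ltW f0] := leP 0 (expect f).
  by apply: (@eldan_gross_minority _ _ _ (-1)) => //; [left|rewrite mulrNN mul1r].
by apply: (@eldan_gross_minority _ _ _ 1) => //; [right|rewrite mul1r oppr_ge0].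
Qed.
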